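(* Let $Y$ be a connected space and $p\in Y$ such that $X=Y\setminus\{p\}$ is almost zero-dimensional. If $K\subset X$ is $\sigma$-compact, then $Y\setminus K$ is connected.
   Context: All spaces are separable and metrizable. A subset $A$ of $X$ is a C-set in $X$ if it is an intersection of clopen subsets of $X$. $X$ is almost zero-dimensional if every point has a neighborhood basis consisting of C-sets in $X$. *)

(* Defs.v *)
(* separable metrizable spaces presented by a metric on a type,
   subspaces presented as subsets (predicates) with the induced metric. *)
From Stdlib Require Import Reals List.
Open Scope R_scope.

Definition is_metric {Y : Type} (d : Y -> Y -> R) : Prop :=
  (forall x y, 0 <= d x y) /\
  (forall x y, d x y = 0 <-> x = y) /\
  (forall x y, d x y = d y x) /\
  (forall x y z, d x z <= d x y + d y z).

Definition separable {Y : Type} (d : Y -> Y -> R) : Prop :=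
  exists s : nat -> Y, forall x eps, 0 < eps -> exists n, d x (s n) < eps.

Definition subset {Y : Type} (A B : Y -> Prop) : Prop := forall x, A x -> B x.

Definition open_in {Y : Type} (d : Y -> Y -> R) (S U : Y -> Prop) : Prop :=
  subset U S /\
  forall x, U x -> exists eps, 0 < eps /\ forall y, S y -> d x y < eps -> U y.

Definition closed_in {Y : Type} (d : Y -> Y -> R) (S A : Y -> Prop) : Prop :=
  subset A S /\ open_in d S (fun y => S y /\ ~ A y).

Definition clopen_in {Y : Type} (d : Y -> Y -> R) (S A : Y -> Prop) : Prop :=
  open_in d S A /\ closed_in d S A.

Definition C_set_in {Y : Type} (d : Y -> Y -> R) (S A : Y -> Prop) : Prop :=
  exists F : (Y -> Prop) -> Prop,
    (forall B, F B -> clopen_in d S B) /\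
    (forall x, A x <-> (S x /\ forall B, F B -> B x)).

Definition nbhd_in {Y : Type} (d : Y -> Y -> R) (S N : Y -> Prop) (x : Y) : Prop :=
  subset N S /\ exists U, open_in d S U /\ U x /\ subset U N.

Definition almost_zero_dimensional {Y : Type} (d : Y -> Y -> R) (S : Y -> Prop) : Prop :=
  forall x U, S x -> nbhd_in d S U x ->
    exists C, C_set_in d S C /\ nbhd_in d S C x /\ subset C U.

Definition connected {Y : Type} (d : Y -> Y -> R) (S : Y -> Prop) : Prop :=
  ~ exists U V, open_in d S U /\ open_in d S V /\
      (exists u, U u) /\ (exists v, V v) /\
      (forall x, U x -> V x -> False) /\
      (forall x, S x -> U x \/ V x).

Definition open_set {Y : Type} (d : Y -> Y -> R) (U : Y -> Prop) : Prop :=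
  open_in d (fun _ => True) U.

Definition compact {Y : Type} (d : Y -> Y -> R) (K : Y -> Prop) : Prop :=
  forall F : (Y -> Prop) -> Prop,
    (forall U, F U -> open_set d U) ->
    (forall x, K x -> exists U, F U /\ U x) ->
    exists l : list (Y -> Prop),
      (forall U, In U l -> F U) /\ (forall x, K x -> exists U, In U l /\ U x).

Definition sigma_compact {Y : Type} (d : Y -> Y -> R) (K : Y -> Prop) : Prop :=
  exists Kn : nat -> Y -> Prop,
    (forall n, compact d (Kn n)) /\ (forall x, K x <-> exists n, Kn n x).

(* Main.v *)
(** Suppose [Y \ K] splits into two relatively open pieces, and enlarge them to
    disjoint open sets [U], containing [p], and [V] of [Y].  Then [Y \ (U ∪ V)]
    is a union of compact sets [L_n] contained in [K].  As [X] is almost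
    zero-dimensional and separable, [V] is the union of the interiors of
    countably many C-sets [E_i ⊆ V].  A compact set is separated from a disjoint
    C-set by a clopen subset of [X], so there are clopen [P_n ⊇ L_n] missing
    [E_0, ..., E_(n+m)], where [m] is fixed with [E_m] nonempty.  Only finitely
    many [P_n] meet each [E_i], hence [V \ ⋃ P_n] is clopen in [Y]; it contains
    [E_m] but not [p], contradicting the connectedness of [Y]. *)
From Stdlib Require Import Reals Lra Lia List Classical IndefiniteDescription.
From Stdlib Require Cantor.
Require Import Defs.
Open Scope R_scope.

Section Metric.

Context {Y : Type} (d : Y -> Y -> R).
Hypothesis metric_d : is_metric d.

(** * Relatively open and clopen sets in a metric space *)

Lemma dist_refl (x : Y) : d x x = 0.
Proof. destruct metric_d as (_ & E & _). now apply E. Qed.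

Lemma dist_sym (x y : Y) : d x y = d y x.
Proof. apply metric_d. Qed.

Lemma dist_tri (x y z : Y) : d x z <= d x y + d y z.
Proof. apply metric_d. Qed.

Lemma dist_pos (x y : Y) : x <> y -> 0 < d x y.
Proof.
  destruct metric_d as (P & E & _). intros H.
  destruct (P x y) as [|H0]; [assumption|].
  exfalso. apply H, E. auto.
Qed.

Lemma open_in_inter (S A B : Y -> Prop) :
  open_in d S A -> open_in d S B -> open_in d S (fun y => A y /\ B y).
Proof.
  intros [sA oA] [sB oB]. split; [intros y [a _]; auto|].
  intros x [Ax Bx].
  destruct (oA x Ax) as (e & e0 & he), (oB x Bx) as (f & f0 & hf).
  exists (Rmin e f). split; [now apply Rmin_pos|].
  intros y Sy h. pose proof (Rmin_l e f). pose proof (Rmin_r e f).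
  split; [apply he | apply hf]; auto; lra.
Qed.

Lemma open_in_union (S A B : Y -> Prop) :
  open_in d S A -> open_in d S B -> open_in d S (fun y => A y \/ B y).
Proof.
  intros [sA oA] [sB oB]. split; [intros y [a|b]; auto|].
  intros x [Ax|Bx].
  - destruct (oA x Ax) as (e & e0 & he). exists e. auto.
  - destruct (oB x Bx) as (e & e0 & he). exists e. auto.
Qed.

Lemma open_in_ext (S A B : Y -> Prop) :
  (forall y, A y <-> B y) -> open_in d S A -> open_in d S B.
Proof.
  intros E [sA oA]. split; [intros y h; now apply sA, E|].
  intros x h. apply E in h. destruct (oA x h) as (e & e0 & he).
  exists e. split; [assumption|]. intros y Sy hy. now apply E, he.
Qed.

Lemma open_in_open (S A : Y -> Prop) :
  open_set d S -> open_in d S A -> open_set d A.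
Proof.
  intros [_ oS] [sA oA]. split; [intros y _; exact I|].
  intros x Ax.
  destruct (oA x Ax) as (e & e0 & he), (oS x (sA x Ax)) as (f & f0 & hf).
  exists (Rmin e f). split; [now apply Rmin_pos|].
  intros y _ h. pose proof (Rmin_l e f). pose proof (Rmin_r e f).
  apply he; [apply hf; [exact I|]|]; lra.
Qed.

Lemma open_open_in (S A : Y -> Prop) :
  subset A S -> open_set d A -> open_in d S A.
Proof.
  intros sA [_ oA]. split; [assumption|].
  intros x Ax. destruct (oA x Ax) as (e & e0 & he). exists e. auto.
Qed.

Lemma open_set_complement_point (p : Y) : open_set d (fun y => y <> p).
Proof.
  split; [intros y _; exact I|].
  intros x hx. exists (d x p). split; [now apply dist_pos|].
  intros y _ h ->. lra.
Qed.

Lemma clopen_in_empty (S : Y -> Prop) : clopen_in d S (fun _ => False).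
Proof.
  split; [|split]; [split; intros ? []|intros ? []|].
  split; [intros y []; assumption|]. intros x []. exists 1. split; [lra|]. auto.
Qed.

Lemma clopen_in_union (S A B : Y -> Prop) :
  clopen_in d S A -> clopen_in d S B -> clopen_in d S (fun y => A y \/ B y).
Proof.
  intros [oA [sA cA]] [oB [sB cB]]. split; [now apply open_in_union|].
  split; [intros y [a|b]; auto|].
  apply open_in_ext with (2 := open_in_inter _ _ _ cA cB). tauto.
Qed.

Lemma clopen_in_inter (S A B : Y -> Prop) :
  clopen_in d S A -> clopen_in d S B -> clopen_in d S (fun y => A y /\ B y).
Proof.
  intros [oA [sA cA]] [oB [sB cB]]. split; [now apply open_in_inter|].
  split; [intros y [a b]; auto|].
  apply open_in_ext with (2 := open_in_union _ _ _ cA cB).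
  intros y. pose proof (sA y). tauto.
Qed.

Lemma clopen_in_compl (S A : Y -> Prop) :
  clopen_in d S A -> clopen_in d S (fun y => S y /\ ~ A y).
Proof.
  intros [oA [sA cA]]. split; [assumption|]. split; [intros y []; assumption|].
  apply open_in_ext with (2 := oA).
  intros y. pose proof (sA y). destruct (classic (A y)); tauto.
Qed.

Lemma clopen_in_ext (S A B : Y -> Prop) :
  (forall y, A y <-> B y) -> clopen_in d S A -> clopen_in d S B.
Proof.
  intros E [oA [sA cA]]. split; [now apply open_in_ext with (1 := E)|].
  split; [intros y h; now apply sA, E|].
  apply open_in_ext with (2 := cA). intros y. rewrite (E y). tauto.
Qed.

(** Provides the default member of the countable cover below, for indices whose ball fits into no
    suitable C-set. *)
Lemma C_set_in_empty (S : Y -> Prop) : C_set_in d S (fun _ => False).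
Proof.
  exists (fun B => B = fun _ => False). split.
  - intros B ->. apply clopen_in_empty.
  - intros x. split; [tauto|]. intros [_ h]. exact (h _ eq_refl).
Qed.

Lemma clopen_in_union_list (S : Y -> Prop) (l : list (Y -> Prop)) :
  (forall U, In U l -> clopen_in d S U) ->
  clopen_in d S (fun y => exists U, In U l /\ U y).
Proof.
  induction l as [|A l IH]; intros h.
  - apply clopen_in_ext with (2 := clopen_in_empty S).
    intros y. split; [tauto|]. now intros (U & [] & _).
  - apply clopen_in_ext with
      (2 := clopen_in_union _ _ _ (h A (or_introl eq_refl))
              (IH (fun U hU => h U (or_intror hU)))).
    intros y. split.
    + intros [a|(U & hU & u)]; [exists A|exists U]; simpl; auto.
    + intros (U & [<-|hU] & u); [left|right; exists U]; auto.
Qed.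

Lemma clopen_in_inter_upto (X : Y -> Prop) (P : nat -> Y -> Prop) (n : nat) :
  (forall i, clopen_in d X (P i)) ->
  clopen_in d X (fun y => forall i, (i <= n)%nat -> P i y).
Proof.
  intros h. induction n as [|n IH].
  - apply clopen_in_ext with (2 := h 0%nat). intros y. split.
    + intros H i hi. now replace i with 0%nat by lia.
    + auto.
  - apply clopen_in_ext with (2 := clopen_in_inter _ _ _ IH (h (S n))).
    intros y. split.
    + intros [H1 H2] i hi. destruct (Nat.eq_dec i (S n)) as [->|]; [auto|].
      apply H1. lia.
    + auto.
Qed.

(** * Compact sets and their separation from C-sets *)

Lemma compact_diff_open (K O : Y -> Prop) :
  compact d K -> open_set d O -> compact d (fun y => K y /\ ~ O y).
Proof.
  intros cK oO F oF cov.
  destruct (cK (fun U => F U \/ U = O)) as (l & lF & lcov).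
  - intros U [h| ->]; auto.
  - intros x Kx. destruct (classic (O x)) as [h|h]; [exists O; auto|].
    destruct (cov x (conj Kx h)) as (U & ? & ?). exists U. auto.
  - assert (H : exists l', (forall U, In U l' -> F U) /\
        forall U, In U l -> U = O \/ In U l').
    { clear lcov. induction l as [|A l IH].
      - exists nil. split; intros U [].
      - destruct IH as (l' & h1 & h2); [intros U hU; apply lF; now right|].
        destruct (lF A (or_introl eq_refl)) as [hA|hA].
        + exists (A :: l'). simpl. split.
          * intros U [<-|]; auto.
          * intros U [<-|hU]; [auto|]. destruct (h2 U hU); auto.
        + exists l'. split; [assumption|]. intros U [<-|hU]; auto. }
    destruct H as (l' & h1 & h2). exists l'. split; [assumption|].
    intros x [Kx nO]. destruct (lcov x Kx) as (U & hU & Ux).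
    destruct (h2 U hU) as [->|]; [contradiction|]. exists U. auto.
Qed.

(** Each point of [K] lies outside some clopen set of the family defining [E], and the complement of
    that set is a clopen neighbourhood missing [E]. Compactness leaves finitely many of these, and
    their union is clopen. *)
Lemma compact_C_set_separation (S K E : Y -> Prop) :
  open_set d S -> compact d K -> subset K S -> C_set_in d S E ->
  (forall y, K y -> E y -> False) ->
  exists P, clopen_in d S P /\ subset K P /\ (forall y, P y -> E y -> False).
Proof.
  intros oS cK sK (F & hF & EF) dis.
  destruct (cK (fun U => clopen_in d S U /\ forall y, U y -> E y -> False))
    as (l & hl & cov).
  - intros U [[oU _] _]. now apply open_in_open with S.
  - intros x Kx.
    destruct (classic (exists B, F B /\ ~ B x)) as [(B & FB & nB)|no].
    + exists (fun y => S y /\ ~ B y). split; [split|auto].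
      * now apply clopen_in_compl, hF.
      * intros y [_ nBy] Ey. apply EF in Ey. now apply nBy, Ey.
    + exfalso. apply (dis x Kx). apply EF. split; [auto|].
      intros B FB. destruct (classic (B x)); [assumption|].
      exfalso. apply no. now exists B.
  - exists (fun y => exists U, In U l /\ U y). split; [|split].
    + apply clopen_in_union_list. intros U hU. now apply hl.
    + exact cov.
    + intros y (U & hU & u). now apply (hl U hU).
Qed.

(** * Countable covers by C-sets *)

(** Balls of radius [1/(k+1)] about a dense sequence form a countable base; for each one contained
    in a C-set inside [V], one such C-set is chosen. *)
Lemma almost_zero_dimensional_countable_cover (X V : Y -> Prop) :
  separable d -> open_set d X -> almost_zero_dimensional d X ->
  open_set d V -> subset V X ->
  exists E : nat -> Y -> Prop,
    (forall i, C_set_in d X (E i)) /\ (forall i, subset (E i) V) /\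
    (forall x, V x -> exists i e, 0 < e /\ forall y, d x y < e -> E i y).
Proof.
  intros (s & dense) oS az oV sV.
  (* The index [i] codes a pair: the place of the centre in [s] and the number [k] that gives the
     radius [1/(k+1)]. *)
  set (ball i y := d (s (fst (Cantor.of_nat i))) y
                   < / INR (S (snd (Cantor.of_nat i)))).
  set (good i C := C_set_in d X C /\ subset C V /\ subset (ball i) C).
  destruct (functional_choice (fun i E => C_set_in d X E /\ subset E V /\
              ((exists C, good i C) -> subset (ball i) E))) as (E & hE).
  { intros i. destruct (classic (exists C, good i C)) as [(C & h1 & h2 & h3)|no].
    - exists C. auto.
    - exists (fun _ => False). split; [apply C_set_in_empty|].
      split; [intros y []|contradiction]. }
  exists E. split; [apply hE|]. split; [apply hE|].
  intros x Vx.
  destruct (az x V (sV x Vx)) as (C & hC & (_ & W & oW & Wx & sW) & sC).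
  { split; [assumption|]. exists V. split; [now apply open_open_in|].
    split; [assumption|]. intros y; auto. }
  destruct (open_in_open _ _ oS oW) as [_ oW'].
  destruct (oW' x Wx) as (e & e0 & he).
  (* Twice the radius stays below [e], so a ball of this radius containing [x] lies in the [e]-ball
     about [x], hence in [C]. *)
  destruct (archimed_cor1 (e / 2)) as (N & hN & N0); [lra|].
  destruct N as [|k]; [lia|].
  assert (r0 : 0 < / INR (S k)) by (apply Rinv_0_lt_compat, lt_0_INR; lia).
  destruct (dense x _ r0) as (n & hn).
  exists (Cantor.to_nat (n, k)), (/ INR (S k) - d x (s n)).
  split; [lra|]. intros y hy.
  apply (hE (Cantor.to_nat (n, k))).
  - exists C. split; [assumption|]. split; [assumption|].
    intros z hz. unfold ball in hz. rewrite Cantor.cancel_of_to in hz.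
    cbn [fst snd] in hz.
    apply sW, he; [exact I|]. pose proof (dist_tri x (s n) z). lra.
  - unfold ball. rewrite Cantor.cancel_of_to. cbn [fst snd].
    pose proof (dist_tri (s n) x y). rewrite (dist_sym (s n) x) in *. lra.
Qed.

(** * The clopen set contradicting connectedness *)

(** The [L n] will be what [U] and [V] leave uncovered. If all these sets covered [Y], moving
    suitable clopen neighbourhoods of the [L n] to the side of [U] would disconnect [Y]. *)
Lemma no_sigma_compact_separator (p v : Y) (U V : Y -> Prop)
    (L : nat -> Y -> Prop) :
  separable d ->
  connected d (fun _ => True) ->
  almost_zero_dimensional d (fun y => y <> p) ->
  open_set d U -> open_set d V -> (forall y, U y -> V y -> False) ->
  U p -> V v ->
  (forall n, compact d (L n)) ->
  (forall n y, L n y -> y <> p /\ ~ V y) ->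
  ~ (forall y, U y \/ V y \/ exists n, L n y).
Proof.
  intros sep conn az oU oV dis Up Vv cL hL cov.
  set (X := fun y => y <> p).
  assert (oX : open_set d X) by apply open_set_complement_point.
  destruct (almost_zero_dimensional_countable_cover X V sep oX az oV)
    as (E & CE & EV & Ecov).
  { intros y Vy ->. now apply (dis p). }
  assert (sepn : forall n, exists P : nat -> Y -> Prop, forall i,
     clopen_in d X (P i) /\ subset (L n) (P i) /\
     (forall y, P i y -> E i y -> False)).
  { intros n. apply (functional_choice (fun i Pi => clopen_in d X Pi /\
      subset (L n) Pi /\ forall y, Pi y -> E i y -> False)).
    intros i. apply compact_C_set_separation; auto.
    - intros y h. now apply (hL n).
    - intros y h Ey. apply (hL n y h). now apply (EV i). }
  apply functional_choice in sepn. destruct sepn as (P & hP).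
  destruct (Ecov v Vv) as (m & e & e0 & he).
  assert (Ev : E m v) by (apply he; rewrite dist_refl; assumption).
  (* The bound [n + m] serves twice: every [P' n] misses [E m], so [v] survives, and [P' n] misses
     [E i] as soon as [n >= i]. *)
  set (P' n y := forall i, (i <= n + m)%nat -> P n i y).
  assert (clP : forall n, clopen_in d X (P' n)).
  { intros n. apply clopen_in_inter_upto. apply hP. }
  apply conn.
  exists (fun y => V y /\ forall n, ~ P' n y), (fun y => U y \/ exists n, P' n y).
  split; [|split; [|split; [|split; [|split]]]].
  - split; [intros y _; exact I|].
    intros x [Vx nP]. destruct (Ecov x Vx) as (i & f & f0 & hf).
    (* Inside [E i] only the [P' n] with [n < i] matter, and finitely many of them are avoided by a
       common ball about [x]. *)
    assert (fin : forall k, exists g, 0 < g /\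
      forall y, d x y < g -> forall n, (n < k)%nat -> ~ P' n y).
    { induction k as [|k (g & g0 & hg)].
      - exists 1. split; [lra|]. intros; lia.
      - destruct (open_in_open _ _ oX (proj2 (proj2 (clP k)))) as [_ ok].
        destruct (ok x) as (g' & g'0 & hg').
        { split; [|apply nP]. intros ->. now apply (dis p). }
        exists (Rmin g g'). split; [now apply Rmin_pos|].
        pose proof (Rmin_l g g'). pose proof (Rmin_r g g').
        intros y hy n hn. destruct (Nat.eq_dec n k) as [->|].
        + apply hg'; [exact I|lra].
        + apply hg; [lra|lia]. }
    destruct (fin i) as (g & g0 & hg).
    exists (Rmin f g). split; [now apply Rmin_pos|].
    pose proof (Rmin_l f g). pose proof (Rmin_r f g).
    intros y _ hy. assert (Ey : E i y) by (apply hf; lra).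
    split; [now apply (EV i)|]. intros n.
    destruct (Nat.lt_ge_cases n i) as [lt|ge].
    + apply hg; [lra|assumption].
    + intros Py. apply (proj2 (proj2 (hP n i)) y); [|assumption].
      apply Py. lia.
  - split; [intros y _; exact I|].
    intros x [Ux|(n & Px)].
    + destruct (proj2 oU x Ux) as (f & f0 & hf). exists f. auto.
    + destruct (proj2 (open_in_open _ _ oX (proj1 (clP n))) x Px)
        as (f & f0 & hf).
      exists f. split; [assumption|]. intros y Ty hy. right. exists n. auto.
  - exists v. split; [assumption|]. intros n Pv.
    apply (proj2 (proj2 (hP n m)) v); [|assumption]. apply Pv. lia.
  - exists p. now left.
  - intros x [Vx nP] [Ux|(n & Px)]; [now apply (dis x)|]. now apply (nP n).
  - intros x _. destruct (classic (exists n, P' n x)) as [h|no]; [auto|].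
    (* [L n] lies in [P' n], so a point outside every [P' n] is in [U] or [V]. *)
    destruct (cov x) as [Ux|[Vx|(n & Lx)]]; [auto| |].
    + left. split; [assumption|]. intros n h. apply no. now exists n.
    + exfalso. apply no. exists n. intros i _. now apply (hP n i).
Qed.

(** * Disjoint open enlargements of relatively open sets *)

(* Balls of half the distance to the other set keep the inflations of [U] and [V]
   disjoint. *)
Definition inflation (U V : Y -> Prop) (y : Y) : Prop :=
  exists v r, V v /\ d v y < r /\ forall u, U u -> 2 * r <= d v u.

Lemma open_set_inflation (U V : Y -> Prop) : open_set d (inflation U V).
Proof.
  split; [intros y _; exact I|].
  intros x (v & r & Vv & hr & far). exists (r - d v x). split; [lra|].
  intros y _ hy. exists v, r. split; [assumption|]. split; [|assumption].
  pose proof (dist_tri v x y). lra.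
Qed.

(** Balls of radii [r] and [q] about [v] and [u] that share [y] give [d v u < r + q], while [d v u]
    is at least [2 * r] and [2 * q]. *)
Lemma inflation_disjoint (U V : Y -> Prop) (y : Y) :
  inflation U V y -> inflation V U y -> False.
Proof.
  intros (v & r & Vv & hr & far) (u & q & Uu & hq & far').
  specialize (far u Uu). specialize (far' v Vv).
  pose proof (dist_tri v y u). rewrite (dist_sym y u), (dist_sym u v) in *. lra.
Qed.

(** A ball of radius [e] about [x] whose points in [S] all lie in [V] contains no point of [U], so
    [e / 2] is an admissible radius. *)
Lemma subset_inflation (S U V : Y -> Prop) :
  open_in d S V -> subset U S -> (forall y, U y -> V y -> False) ->
  subset V (inflation U V).
Proof.
  intros [_ oV] sU dis x Vx. destruct (oV x Vx) as (e & e0 & he).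
  exists x, (e / 2). split; [assumption|]. split; [rewrite dist_refl; lra|].
  intros u Uu. destruct (Rlt_or_le (d x u) e) as [h|h]; [|lra].
  exfalso. apply (dis u Uu). auto.
Qed.

(** The pieces are open only relative to the complement of [K], so their inflations replace them;
    what these miss lies in [K] and is a countable union of compact sets. *)
Lemma no_separation_off_sigma_compact (p : Y) (K U V : Y -> Prop) :
  separable d ->
  connected d (fun _ => True) ->
  almost_zero_dimensional d (fun y => y <> p) ->
  subset K (fun y => y <> p) ->
  sigma_compact d K ->
  open_in d (fun y => ~ K y) U -> open_in d (fun y => ~ K y) V ->
  U p -> (exists v, V v) -> (forall y, U y -> V y -> False) ->
  ~ (forall y, ~ K y -> U y \/ V y).
Proof.
  intros sep conn az sK (Kn & cK & hK) oU oV Up (v & Vv) dis cov.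
  pose proof (subset_inflation _ _ _ oV (proj1 oU) dis) as sV.
  pose proof (subset_inflation _ _ _ oU (proj1 oV) (fun y a b => dis y b a)) as sU.
  apply (no_sigma_compact_separator p v (inflation V U) (inflation U V)
    (fun n y => (Kn n y /\ ~ inflation V U y) /\ ~ inflation U V y)); auto.
  - apply open_set_inflation.
  - apply open_set_inflation.
  - intros y a b. exact (inflation_disjoint U V y b a).
  - intros n. apply (compact_diff_open (fun y => Kn n y /\ ~ inflation V U y));
      [apply compact_diff_open; [apply cK|] |]; apply open_set_inflation.
  - intros n y [[h _] nV]. split; [|assumption]. apply sK, hK. now exists n.
  - intros y. destruct (classic (inflation V U y)) as [|nU]; [auto|].
    destruct (classic (inflation U V y)) as [|nV]; [auto|].
    right. right. destruct (classic (K y)) as [Ky|nK].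
    + apply hK in Ky. destruct Ky as (n & h). exists n. auto.
    + exfalso. destruct (cov y nK); auto.
Qed.

End Metric.

Theorem theorem4p8 (Y : Type) (d : Y -> Y -> R) (p : Y) (K : Y -> Prop) :
  is_metric d -> separable d ->
  connected d (fun _ => True) ->
  almost_zero_dimensional d (fun y => y <> p) ->
  subset K (fun y => y <> p) ->
  sigma_compact d K ->
  connected d (fun y => ~ K y).
Proof.
  intros md sep conn az sK sig (U & V & oU & oV & neU & neV & dis & cov).
  (* [p] is not in [K], so it lies in one of the two pieces, whose roles are interchangeable. *)
  destruct (cov p) as [Up|Vp]; [intros Kp; now apply (sK p)| |].
  - now apply (no_separation_off_sigma_compact d md p K U V).
  - apply (no_separation_off_sigma_compact d md p K V U); auto.
    + intros y a b. now apply (dis y).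
    + intros y h. destruct (cov y h); auto.
Qed.
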